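(* Let $a,b\in\mathbb{R}$ with $a,b>-1$, let $c\in\mathbb{R}$ with $c>0$, and let $a',b'\in\mathbb{R}$ with $a',b'>1$. For each of the weights $\gamma^{(a,b)}$, $\gamma^{(c)}$, $\delta^{(a',b')}$ and each $n\ge1$ such that $\{0,\ldots,n-1\}$ is contained in its domain, the corresponding weighted involutive walk on $\{0,\ldots,n-1\}$ is irreducible, recurrent, reversible and ergodic. In each case the unique invariant distribution is $\pi$, where for $x\in\{0,\ldots,n-1\}$, $\pi_x$ is proportional to - $\binom{n-1-x+a}{n-1-x}\binom{x+a+b+1}{x}$ for $\gamma^{(a,b)}$; - $\binom{n-1}{x}\bigl(\frac{c+1}{c}\bigr)^x$ for $\gamma^{(c)}$; - $\binom{a'-1}{n-1-x}\binom{(a'-1)+(b'-1)}{x}$ for $\delta^{(a',b')}$. The eigenvalues of the transition matrices, for $d\in\{0,1,\ldots,n-1\}$, are: - $(-1)^d\binom{a+d}{d}\big/\binom{a+b+d+1}{d}$ for $P(\gamma^{(a,b)})$; - $(-1)^d/(c+1)^d$ for $P(\gamma^{(c)})$; - $(-1)^d\binom{a'-1}{d}\big/\binom{(a'-1)+(b'-1)}{d}$ for $P(\delta^{(a',b')})$. In each case, up to the signs $(-1)^d$, these are the anti-diagonal entries $P_{d,\,n-1-d}$ of the transition matrix $P$.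
   Context: Binomial coefficients are $\binom{r}{d}=r(r-1)\cdots(r-d+1)/d!$ for $r\in\mathbb{R}$, $d\in\mathbb{N}_0$. For $x,y\in\mathbb{N}_0$, $[y,x]=\{y,\ldots,x\}$ (empty if $y>x$). A weight with domain $D$, where $D=\mathbb{N}_0$ or $D=\{0,1,\ldots,N-1\}$, is a function $\gamma$ on intervals of $D$ with non-negative real values $\gamma_{[y,x]}$, with $\gamma_\varnothing=0$ and $N(\gamma)_x:=\sum_{y=0}^x\gamma_{[y,x]}>0$ for all $x\in D$. The $\gamma$-weighted involutive walk on $\{0,\ldots,n-1\}$ (where this set is contained in the domain of $\gamma$) is the Markov chain in which, from state $x$, one chooses $y\in\{0,\ldots,x\}$ with probability $\gamma_{[y,x]}/N(\gamma)_x$ and steps to $y^\star=n-1-y$. Its transition matrix is $P(\gamma)_{xz}=\gamma_{[z^\star,x]}/N(\gamma)_x$ (rows and columns numbered from $0$). It is reversible if it has an invariant distribution $\pi$ with $\pi_xP_{xz}=\pi_zP_{zx}$ for all $x,z$. It is ergodic if it is irreducible and aperiodic. For $y\le x$ define $$\gamma^{(a,b)}_{[y,x]}=\binom{y+a}{y}\binom{b+x-y}{x-y}\quad(a,b>-1),\qquad \gamma^{(c)}_{[y,x]}=\binom{x}{y}c^{x-y}\quad(c>0),$$ both with domain $\mathbb{N}_0$, and $$\delta^{(a',b')}_{[y,x]}=\binom{a'-1}{y}\binom{b'-1}{x-y}\quad(a',b'>1),$$ with domain $\{0,\ldots,N-1\}$ where $N=\min(\lceil a'\rceil,\lceil b'\rceil)$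 if $b'\notin\mathbb{N}$, and $N=\lceil a'\rceil$ if $b'\in\mathbb{N}$.
   Formalization: For γ^(c) the invariant distribution is stated proportional to binom(n-1,x)(c+1)^x instead of binom(n-1,x)((c+1)/c)^x: the printed formula fails for every c ≠ 1, n ≥ 2 (for n = 2, π is proportional to (1, c+1)). *)

(* Defs.v *)
From HB Require Import structures.
From mathcomp Require Import all_boot all_order all_algebra.
From mathcomp Require Import classical_sets reals topology normedtype sequences.

Set Implicit Arguments.
Unset Strict Implicit.
Unset Printing Implicit Defensive.

Import Order.TTheory GRing.Theory Num.Theory.
Import numFieldNormedType.Exports.

Local Open Scope classical_set_scope.
Local Open Scope ring_scope.

Section Binomial.
Variable R : realType.
Implicit Type r : R.

Definition rbinom r (d : nat) : R := (\prod_(i < d) (r - i%:R)) / d`!%:R.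

Lemma rbinom0 r : rbinom r 0 = 1.
Proof. by rewrite /rbinom big_ord0 fact0 divr1. Qed.

Lemma rbinom_gt0 r d : d%:R < r + 1 -> 0 < rbinom r d.
Proof.
move=> dr; rewrite /rbinom divr_gt0 ?ltr0n ?fact_gt0 //.
apply: prodr_gt0 => i _; rewrite subr_gt0 -(ltrD2r 1).
by apply: le_lt_trans dr; rewrite natr1 ler_nat.
Qed.

(* A negative factor can only occur after the factor [m - m]. *)
Lemma rbinom_nat_ge0 (m d : nat) : 0 <= rbinom m%:R d.
Proof.
case: (ltnP d m.+1) => [dm|md].
  by apply/ltW/rbinom_gt0; rewrite natr1 ltr_nat.
by rewrite /rbinom (bigD1 (Ordinal md)) //= subrr !mul0r.
Qed.

End Binomial.

(* [Some N] encodes the domain {0, ..., N-1}, and [None] the domain of all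
   natural numbers. *)
Definition in_domain (D : option nat) (x : nat) : bool :=
  if D is Some N then (x < N)%N else true.

(* [g y x] is the weight of the interval [y, x] = {y, ..., x}.  All the
   intervals with x < y are the empty set, hence [weight_empty]; the values at
   intervals not contained in the domain are irrelevant. *)
Record weight (R : realType) := Weight {
  weight_dom : option nat;
  weight_val :> nat -> nat -> R;
  weight_empty : forall y x, (x < y)%N -> weight_val y x = 0;
  weight_ge0 : forall y x, (y <= x)%N -> in_domain weight_dom x ->
    0 <= weight_val y x;
  weight_norm_gt0 : forall x, in_domain weight_dom x ->
    0 < \sum_(y < x.+1) weight_val y x
}.

Section Walk.
Variable R : realType.
Implicit Type g : weight R.

Definition weight_norm g (x : nat) : R := \sum_(y < x.+1) g y x.

(* [rev_ord z] is z^* = n - 1 - z. *)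
Definition walk_matrix g (n : nat) : 'M[R]_n :=
  \matrix_(x, z) (g (rev_ord z) x / weight_norm g x).

Lemma walk_matrix_stochastic g n (x : 'I_n) :
  (forall y : nat, (y < n)%N -> in_domain (weight_dom g) y) ->
  (forall z, 0 <= walk_matrix g n x z) /\ \sum_z walk_matrix g n x z = 1.
Proof.
move=> dom; have dx := dom _ (ltn_ord x); have Ngt0 := weight_norm_gt0 dx.
split=> [z|].
  rewrite mxE divr_ge0 ?(ltW Ngt0) //.
  by case: (leqP (rev_ord z) x) => yx; [exact: weight_ge0 | rewrite weight_empty].
under eq_bigr do rewrite mxE.
rewrite -mulr_suml (reindex_inj rev_ord_inj).
under eq_bigr => y _ do rewrite rev_ordK.
suff -> : \sum_(y < n) g y x = weight_norm g x by rewrite divff ?gt_eqF.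
rewrite /weight_norm (big_ord_widen n (fun y => g y x) (ltn_ord x)) [RHS]big_mkcond.
by apply: eq_bigr => y _; case: ltnP => // xy; rewrite weight_empty.
Qed.

End Walk.

(* Markov chains on 'I_n, given by their transition matrices. *)
Section Markov.
Variables (R : realType) (n : nat).
Implicit Types (P : 'M[R]_n) (pi : 'rV[R]_n).

Definition mc_irreducible P : Prop :=
  forall x z : 'I_n, exists2 k : nat, (0 < k)%N & 0 < (P ^+ k) x z.

(* For each x, 1 is the gcd of the set of all k > 0 such that the chain can
   return to x in k steps; the gcd is characterised by its divisors. *)
Definition mc_aperiodic P : Prop :=
  forall (x : 'I_n) (e : nat),
    (forall k : nat, (0 < k)%N -> 0 < (P ^+ k) x x -> (e %| k)%N) <->
    (e %| 1)%N.

Definition mc_ergodic P : Prop := mc_irreducible P /\ mc_aperiodic P.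

(* The probability that the chain started at x follows the path s. *)
Fixpoint path_prob P (x : 'I_n) (s : seq 'I_n) : R :=
  if s is y :: s' then P x y * path_prob P y s' else 1.

(* The probability that the chain started at x first returns to x at time
   k + 1. *)
Definition first_return_prob P (x : 'I_n) (k : nat) : R :=
  \sum_(s : k.-tuple 'I_n | x \notin s) path_prob P x (rcons s x).

(* From any state, the chain returns to this state with probability 1. *)
Definition mc_recurrent P : Prop :=
  forall x : 'I_n, series (first_return_prob P x) @ \oo --> (1 : R).

Definition invariant_distribution P pi : Prop :=
  [/\ forall x, 0 <= pi 0 x, \sum_x pi 0 x = 1 & pi *m P = pi].

Definition mc_reversible P : Prop :=
  exists2 pi, invariant_distribution P pi &
    forall x z, pi 0 x * P x z = pi 0 z * P z x.

Definition proportional_to pi (w : nat -> R) : Prop :=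
  exists2 k : R, k != 0 & forall x : 'I_n, pi 0 x = k * w x.

(* The second component says that the eigenvalues are listed with their
   multiplicities, and that there are no further complex eigenvalues. *)
Definition has_eigenvalues P (lam : nat -> R) : Prop :=
  (forall l : R, eigenvalue P l <-> exists d : 'I_n, l = lam d) /\
  char_poly P = \prod_(d < n) ('X - (lam d)%:P).

End Markov.

Section GammaAB.
Variables (R : realType) (a b : R).
Hypotheses (ha : -1 < a) (hb : -1 < b).

Definition gamma_ab_val (y x : nat) : R :=
  if (y <= x)%N then rbinom (y%:R + a) y * rbinom (b + (x - y)%:R) (x - y)
  else 0.

Let gamma_ab_empty y x : (x < y)%N -> gamma_ab_val y x = 0.
Proof. by move=> xy; rewrite /gamma_ab_val leqNgt xy. Qed.

Let gamma_ab_gt0 y x : (y <= x)%N -> 0 < gamma_ab_val y x.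
Proof.
rewrite /gamma_ab_val => ->; rewrite mulr_gt0 // rbinom_gt0 //.
  by rewrite -addrA ltrDl -ltrBlDr sub0r.
by rewrite addrAC ltrDr -ltrBlDr sub0r.
Qed.

Let gamma_ab_ge0 y x :
  (y <= x)%N -> in_domain None x -> 0 <= gamma_ab_val y x.
Proof. by move=> yx _; apply/ltW/gamma_ab_gt0. Qed.

Let gamma_ab_norm_gt0 x :
  in_domain None x -> 0 < \sum_(y < x.+1) gamma_ab_val y x.
Proof.
move=> _; rewrite big_ord_recr ltr_wpDl //=; last exact: gamma_ab_gt0.
by apply: sumr_ge0 => y _; apply/ltW/gamma_ab_gt0/ltnW.
Qed.

Definition gamma_ab : weight R :=
  Weight gamma_ab_empty gamma_ab_ge0 gamma_ab_norm_gt0.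

End GammaAB.

Section GammaC.
Variables (R : realType) (c : R).
Hypothesis hc : 0 < c.

Definition gamma_c_val (y x : nat) : R := 'C(x, y)%:R * c ^+ (x - y).

Let gamma_c_empty y x : (x < y)%N -> gamma_c_val y x = 0.
Proof. by move=> xy; rewrite /gamma_c_val bin_small // mul0r. Qed.

Let gamma_c_ge0 y x : (y <= x)%N -> in_domain None x -> 0 <= gamma_c_val y x.
Proof. by move=> _ _; rewrite mulr_ge0 ?exprn_ge0 // ltW. Qed.

Let gamma_c_norm_gt0 x :
  in_domain None x -> 0 < \sum_(y < x.+1) gamma_c_val y x.
Proof.
move=> _; rewrite big_ord_recr ltr_wpDl //=; last first.
  by rewrite /gamma_c_val binn subnn mulr1 ltr01.
by apply: sumr_ge0 => y _; apply/gamma_c_ge0 => //; apply: ltnW.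
Qed.

(* From x, the chosen y has the binomial distribution B(x, 1/(c+1)).  If X has
   distribution B(n-1, p) then y^* has distribution B(n-1, 1 - p/(c+1)), so
   the invariant distribution has p/(1-p) = c+1: it is proportional to
   'C(n-1, x) (c+1)^x.  It is not proportional to 'C(n-1, x) ((c+1)/c)^x
   unless c = 1 or n = 1: for n = 2 one has pi_0 = pi_1/(c+1). *)
Definition gamma_c : weight R :=
  Weight gamma_c_empty gamma_c_ge0 gamma_c_norm_gt0.

End GammaC.

Section Delta.
Variables (R : realType) (a b : R).
Hypotheses (ha : 1 < a) (hb : 1 < b).

(* The ceilings are integers, positive since a, b > 1. *)
Definition delta_size : nat :=
  if b \is a Num.nat then `|Num.ceil a|%N
  else minn `|Num.ceil a|%N `|Num.ceil b|%N.

Definition delta_val (y x : nat) : R :=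
  if (y <= x)%N then rbinom (a - 1) y * rbinom (b - 1) (x - y) else 0.

Let delta_empty y x : (x < y)%N -> delta_val y x = 0.
Proof. by move=> xy; rewrite /delta_val leqNgt xy. Qed.

Let lt_ceil (r : R) (x : nat) : 1 < r -> (x < `|Num.ceil r|)%N -> x%:R < r.
Proof.
move=> r1; rewrite -(ltz_nat x) gez0_abs ?ceil_ge0; last first.
  exact: lt_trans (ltrN10 R) (lt_trans ltr01 r1).
by rewrite ceil_gt_int.
Qed.

Let delta_a_gt0 y x :
  (y <= x)%N -> in_domain (Some delta_size) x -> 0 < rbinom (a - 1) y.
Proof.
move=> yx /= xN; apply: rbinom_gt0; rewrite subrK; apply: lt_ceil => //.
apply: leq_ltn_trans yx (leq_trans xN _); rewrite /delta_size.
by case: ifP => // _; apply: geq_minl.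
Qed.

Let delta_b_ge0 y x : in_domain (Some delta_size) x ->
  0 <= rbinom (b - 1) (x - y).
Proof.
rewrite /= /delta_size; case: ifPn => [/natrP[m bm] _|_ xN].
  have m0 : (0 < m)%N by rewrite -(ltr_nat R) -bm (lt_trans _ hb).
  by rewrite bm -[1]/(1%:R) -natrB // rbinom_nat_ge0.
apply/ltW/rbinom_gt0; rewrite subrK; apply: lt_ceil => //.
exact: leq_ltn_trans (leq_subr _ _) (leq_trans xN (geq_minr _ _)).
Qed.

Let delta_ge0 y x :
  (y <= x)%N -> in_domain (Some delta_size) x -> 0 <= delta_val y x.
Proof.
move=> yx dx; rewrite /delta_val yx mulr_ge0 ?delta_b_ge0 //.
exact/ltW/(delta_a_gt0 yx).
Qed.

Let delta_norm_gt0 x : in_domain (Some delta_size) x ->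
  0 < \sum_(y < x.+1) delta_val y x.
Proof.
move=> dx; rewrite big_ord_recr ltr_wpDl //=.
  by apply: sumr_ge0 => y _; apply: delta_ge0 => //; apply: ltnW.
by rewrite /delta_val leqnn subnn rbinom0 mulr1 (delta_a_gt0 (leqnn x)).
Qed.

Definition delta_ab : weight R :=
  Weight delta_empty delta_ge0 delta_norm_gt0.

End Delta.

(* Main.v *)
(* All three weights have the form gamma_[y,x] = u_y v_(x-y) / k_x, so that
   pi_x = u_(n-1-x) k_x N(gamma)_x satisfies detailed balance.  Since
   u, v_0, v_1 > 0, the walk can step from x to n-1-x and to n-x, whence it is
   irreducible with a loop at floor(n/2).  By Vandermonde's convolution,
   averaging over the choice of y multiplies the function x |-> 'C(x, d) by a
   scalar lambda_d, and y |-> n-1-y acts on polynomials of degree d by (-1)^d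
   up to lower degree; so the transition matrix is conjugate to a triangular
   one with diagonal entries (-1)^d lambda_d. *)
Require Import Defs.
From HB Require Import structures.
From mathcomp Require Import all_boot all_order all_algebra.
From mathcomp Require Import boolp classical_sets reals topology.
From mathcomp Require Import normedtype sequences.
From mathcomp Require Import ring lra zify.

Import Order.TTheory GRing.Theory Num.Theory.
Import numFieldNormedType.Exports.

Local Open Scope ring_scope.

(** * Characteristic polynomials of triangular and of conjugate matrices *)

Section TriangularConjugate.
Variables (R : idomainType) (n : nat).
Implicit Types A B T : 'M[R]_n.

Lemma char_poly_upper_trig A :
  (forall i j : 'I_n, (j < i)%N -> A i j = 0) ->
  char_poly A = \prod_(i < n) ('X - (A i i)%:P).
Proof.
move=> A0; transitivity (char_poly A^T).
  rewrite /char_poly -[LHS]det_tr; congr (\det _).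
  by apply/matrixP => i j; rewrite !mxE eq_sym.
rewrite char_poly_trig; first by apply: eq_bigr => i _; rewrite mxE.
by apply/is_trig_mxP => i j ij; rewrite mxE A0.
Qed.

(** Over an integral domain no inverse of [B] is taken: the intertwining relation lifts to the
    characteristic matrices, and the nonzero constant polynomial det [B] cancels from the
    determinants. *)
Lemma char_poly_conj A B T :
  \det B != 0 -> A *m B = B *m T -> char_poly A = char_poly T.
Proof.
move=> B0 AB.
have : char_poly_mx A *m map_mx polyC B = map_mx polyC B *m char_poly_mx T.
  rewrite /char_poly_mx mulmxBl mulmxBr -!map_mxM /= AB; congr (_ - _).
  by rewrite mul_scalar_mx mul_mx_scalar.
move=> /(congr1 determinant); rewrite !det_mulmx mulrC.
by apply: mulfI; rewrite det_map_mx polyC_eq0.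
Qed.

End TriangularConjugate.

Lemma eigenvalues_of_char_poly (F : fieldType) (n : nat) (A : 'M[F]_n)
    (lam : nat -> F) :
  char_poly A = \prod_(d < n) ('X - (lam d)%:P) ->
  forall l, eigenvalue A l <-> exists d : 'I_n, l = lam d.
Proof.
move=> Alam l; rewrite eigenvalue_root_char Alam /root horner_prod prodf_seq_eq0.
split=> [/hasP[d _]|[d ->]].
  by rewrite hornerXsubC subr_eq0 => /eqP ->; exists d.
apply/hasP; exists d; first exact: mem_index_enum.
by rewrite /= hornerXsubC subrr.
Qed.

(** * Reflected binomial coefficients *)

Section BinomialMatrix.
Variable R : comNzRingType.

(* Coefficient extraction in (1 + X)^(m-y) ((1 + X) - X)^y. *)
Lemma bin_sub (m y d : nat) : (y <= m)%N ->
  'C(m - y, d)%:R =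
    \sum_(e < d.+1) (-1) ^+ e * 'C(y, e)%:R * 'C(m - e, d - e)%:R :> R.
Proof.
move=> ym.
have coef1X k i : ((1 + 'X) ^+ k : {poly R})`_i = 'C(k, i)%:R.
  rewrite exprDn coef_sum.
  under eq_bigr => j _ do rewrite expr1n mul1r coefMn coefXn.
  case: (ltnP i k.+1) => ik; last first.
    rewrite bin_small // big1 // => j _.
    by rewrite gtn_eqF ?mul0rn // (leq_trans (ltn_ord j)).
  rewrite (bigD1 (Ordinal ik)) //= eqxx big1 ?addr0 // => j /negPf ji.
  by rewrite -[i]/(nat_of_ord (Ordinal ik)) eq_sym (inj_eq val_inj) ji mul0rn.
transitivity ((\sum_(e < y.+1) ((-1) ^+ e * 'C(y, e)%:R)%:P *
     ('X^e * (1 + 'X) ^+ (m - e)) : {poly R})`_d).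
  rewrite -coef1X; congr (polyseq _)`_d; rewrite -[LHS]mulr1.
  have one : 1 = ((1 + 'X) - 'X) ^+ y :> {poly R} by rewrite addrK expr1n.
  rewrite [X in _ * X = _]one exprBn mulr_sumr; apply: eq_bigr => e _.
  have ey : (e <= y)%N by rewrite -ltnS ltn_ord.
  have -> : (m - e = (m - y) + (y - e))%N by lia.
  by rewrite exprD -mulr_natr rmorphM rmorphXn rmorphN1 rmorph_nat /=; ring.
rewrite coef_sum.
under eq_bigr => e _ do rewrite coefCM coefXnM coef1X.
set F := fun e : nat => (-1) ^+ e * 'C(y, e)%:R *
  (if (d < e)%N then 0 else 'C(m - e, d - e)%:R) : R.
(* [F] vanishes for e > y and for e > d, so the sums up to y and up to d agree with the sum over a
   common longer range. *)
transitivity (\sum_(e < (y + d).+1) F e).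
  rewrite -[LHS]/(\sum_(e < y.+1) F e).
  rewrite (big_ord_widen (y + d).+1 F) ?ltnS ?leq_addr // big_mkcond.
  apply: eq_bigr => e _; case: ltnP => // ye.
  by rewrite /F bin_small // mulr0 mul0r.
transitivity (\sum_(e < d.+1) F e).
  rewrite [RHS](big_ord_widen (y + d).+1 F) ?ltnS ?leq_addl // [RHS]big_mkcond.
  apply: eq_bigr => e _; case: ltnP => // de.
  by rewrite /F ifT // mulr0.
by apply: eq_bigr => e _; rewrite /F ltnNge -ltnS ltn_ord.
Qed.

End BinomialMatrix.

(** * Recurrence from a positive invariant vector *)

Section Recurrence.
Local Open Scope classical_set_scope.
Local Open Scope ring_scope.
Variables (R : realType) (n : nat) (P : 'M[R]_n).
Hypothesis P_stochastic :
  forall y : 'I_n, (forall z, 0 <= P y z) /\ \sum_z P y z = 1.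

(** The probability that the chain started at y avoids x at times 1, ..., k. Time 0 is exempt, so y
    = x is allowed. *)
Fixpoint avoid_prob (x : 'I_n) (k : nat) (y : 'I_n) : R :=
  if k is k'.+1 then \sum_(z | z != x) P y z * avoid_prob x k' z else 1.

Lemma avoid_prob_ge0 x k y : 0 <= avoid_prob x k y.
Proof.
elim: k y => [|k IH] y /=; first exact: ler01.
by apply: sumr_ge0 => z _; rewrite mulr_ge0 // (P_stochastic y).1.
Qed.

(** The first visit to x is at time k + 1 exactly when x is avoided for k steps but not for k +
    1. *)
Lemma hitting_prob x k y :
  \sum_(s : k.-tuple 'I_n | x \notin s) path_prob P y (rcons s x) =
  avoid_prob x k y - avoid_prob x k.+1 y.
Proof.
elim: k y => [|k IH] y.
  rewrite (big_pred1 [tuple]) => [|s]; last by rewrite tuple0 /= eqxx.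
  rewrite /= mulr1; under eq_bigr do rewrite mulr1.
  by rewrite -(P_stochastic y).2 [X in _ = X - _](bigD1 x) //= addrK.
(* Paths are split into the first visited state and the rest. *)
rewrite (reindex (fun p : 'I_n * k.-tuple 'I_n => [tuple of p.1 :: p.2])) /=.
  under eq_bigl => p do rewrite inE negb_or eq_sym.
  rewrite -(pair_big_dep (fun z => z != x)
    (fun _ (s : k.-tuple 'I_n) => x \notin s)
    (fun z (s : k.-tuple 'I_n) => P y z * path_prob P z (rcons s x))) -sumrB.
  by apply: eq_bigr => z _; rewrite -mulr_sumr IH mulrBr.
exists (fun t => (thead t, behead_tuple t)) => [[z s] _|t _] /=.
  by rewrite theadE; congr pair; apply: val_inj.
by rewrite [in RHS](tuple_eta t).
Qed.

(* With S_k the probability of avoiding x for k steps when started from pi,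
   invariance gives pi_x * avoid_prob x k x = S_k - S_(k+1), and S converges. *)
Lemma recurrent_of_invariant (pi : 'rV[R]_n) :
  (forall x, 0 < pi 0 x) -> pi *m P = pi -> mc_recurrent P.
Proof.
move=> pi0 piP x.
pose S k := \sum_y pi 0 y * avoid_prob x k y.
have SS k : S k.+1 = S k - pi 0 x * avoid_prob x k x.
  rewrite /S [in RHS](bigD1 x) //= addrAC subrr add0r.
  under eq_bigr => y _ do rewrite mulr_sumr.
  rewrite exchange_big /=; apply: eq_bigr => z _.
  rewrite -[in RHS]piP mxE mulr_suml.
  by apply: eq_bigr => y _; rewrite mulrA.
have S0 k : 0 <= S k.
  by apply: sumr_ge0 => y _; rewrite mulr_ge0 ?avoid_prob_ge0 // ltW.
have Scvg : cvgn S.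
  apply: nonincreasing_is_cvgn; last by exists 0 => _ [k _ <-].
  apply/nonincreasing_seqP => k; rewrite SS gerBl.
  by rewrite mulr_ge0 ?avoid_prob_ge0 // ltW.
have avoid_cvg : avoid_prob x ^~ x @ \oo --> (0 : R).
  have -> : avoid_prob x ^~ x = fun k => (pi 0 x)^-1 * (S k - S k.+1).
    by apply/funext => k; rewrite SS opprB addrC subrK mulKf // gt_eqF.
  rewrite -(mulr0 (pi 0 x)^-1) -(subrr (limn S)).
  apply: cvgMl_tmp; apply: cvgB => //.
  by rewrite (cvg_shiftS S).
(* By [hitting_prob] the partial sums telescope. *)
have -> : series (first_return_prob P x) = fun k => 1 - avoid_prob x k x.
  apply/funext => k; rewrite seriesEnat /=.
  under eq_bigr => j _ do rewrite /first_return_prob hitting_prob -opprB.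
  by rewrite sumrN telescope_sumr // opprB.
by rewrite -[X in _ --> X]subr0; apply: cvgB => //; exact: cvg_cst.
Qed.

End Recurrence.

(** * Densities of invariant vectors *)

Section StochasticMatrix.
Variables (R : realType) (n : nat) (P : 'M[R]_n).
Hypothesis P_stochastic :
  forall y : 'I_n, (forall z, 0 <= P y z) /\ \sum_z P y z = 1.

(* The Dirichlet form of the density of mu with respect to pi vanishes. *)
Lemma invariant_density_step (pi mu : 'rV[R]_n) (x z : 'I_n) :
  (forall x, 0 < pi 0 x) -> pi *m P = pi -> mu *m P = mu ->
  0 < P x z -> mu 0 x / pi 0 x = mu 0 z / pi 0 z.
Proof.
move=> pi0 piP muP Pxz.
pose h x := mu 0 x / pi 0 x.
have muE y : mu 0 y = pi 0 y * h y by rewrite /h mulrC divfK // gt_eqF.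
pose D x z := pi 0 x * P x z * (h x - h z) ^+ 2.
have D0 y t : 0 <= D y t.
  apply: mulr_ge0; last exact: sqr_ge0.
  by apply: mulr_ge0; [exact/ltW | exact: (P_stochastic y).1].
have sumD : \sum_y \sum_t D y t = 0.
  (* Expanding the square gives E + E - 2E: the row sums yield the first term, invariance of [pi]
     the second, invariance of [mu] the cross term. *)
  pose E := \sum_y pi 0 y * h y ^+ 2.
  have E1 : \sum_y \sum_t pi 0 y * P y t * h y ^+ 2 = E.
    apply: eq_bigr => y _; rewrite -[in RHS](mulr1 (pi 0 y)).
    by rewrite -(P_stochastic y).2 mulr_sumr mulr_suml.
  have E2 : \sum_y \sum_t pi 0 y * P y t * h t ^+ 2 = E.
    rewrite exchange_big /=; apply: eq_bigr => t _.
    by rewrite -mulr_suml -[in RHS]piP mxE.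
  have E3 : \sum_y \sum_t mu 0 y * P y t * h t = E.
    rewrite exchange_big /=; apply: eq_bigr => t _.
    by rewrite -mulr_suml expr2 mulrA -muE -[in RHS]muP mxE.
  transitivity (E + E - 2 * E); last by ring.
  rewrite -{1}E1 -{1}E2 -{1}E3 mulr_sumr -!big_split -sumrB /=.
  apply: eq_bigr => y _.
  rewrite mulr_sumr -big_split -sumrB /=; apply: eq_bigr => t _.
  by rewrite /D muE; ring.
have : D x z = 0.
  have := sumD => /eqP; rewrite psumr_eq0 => [|y _]; last exact: sumr_ge0.
  move=> /allP/(_ x (mem_index_enum _)) /=.
  rewrite psumr_eq0 // => /allP/(_ z (mem_index_enum _)) /= /eqP //.
move=> /eqP; rewrite mulf_eq0 sqrf_eq0 subr_eq0 gt_eqF ?mulr_gt0 //=.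
by move=> /eqP.
Qed.

End StochasticMatrix.

(** * Powers of a stochastic matrix, aperiodicity and uniqueness *)

Section StochasticPowers.
Variables (R : realType) (n : nat) (P : 'M[R]_n).
Hypothesis P_stochastic :
  forall y : 'I_n, (forall z, 0 <= P y z) /\ \sum_z P y z = 1.

Lemma expmx_stochastic k (y : 'I_n) :
  (forall z, 0 <= (P ^+ k) y z) /\ \sum_z (P ^+ k) y z = 1.
Proof.
elim: k y => [|k IH] y.
  rewrite expr0; split=> [z|]; first by rewrite mxE ler0n.
  rewrite (bigD1 y) //= mxE eqxx big1 ?addr0 // => z /negPf zy.
  by rewrite mxE eq_sym zy.
rewrite exprS; split=> [z|].
  rewrite mxE; apply: sumr_ge0 => i _.
  by rewrite mulr_ge0 ?(P_stochastic y).1 ?(IH i).1.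
under eq_bigr => z _ do rewrite mxE.
rewrite exchange_big /= -[RHS](P_stochastic y).2.
by apply: eq_bigr => i _; rewrite -mulr_sumr (IH i).2 mulr1.
Qed.

Lemma expmxD_gt0 i j (x y z : 'I_n) :
  0 < (P ^+ i) x y -> 0 < (P ^+ j) y z -> 0 < (P ^+ (i + j)) x z.
Proof.
move=> xy yz; rewrite exprD mxE (bigD1 y) //= ltr_pwDl ?mulr_gt0 //.
apply: sumr_ge0 => t _.
by rewrite mulr_ge0 ?(expmx_stochastic _ _).1.
Qed.

(** A closed walk from x through l has length i + j, or i + j + 1 if the loop is inserted; a common
    divisor of both lengths divides 1. *)
Lemma aperiodic_of_loop (l : 'I_n) :
  mc_irreducible P -> 0 < P l l -> mc_aperiodic P.
Proof.
move=> irr Pl x e; split=> [He|e1 k _ _]; last exact: dvdn_trans e1 (dvd1n k).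
have [i i0 Pi] := irr x l; have [j _ Pj] := irr l x.
have ij : (e %| i + j)%N.
  by apply: He; [rewrite addn_gt0 i0 | exact: expmxD_gt0 Pi Pj].
rewrite -(dvdn_addr _ ij); apply: He; first by rewrite addn1.
rewrite addnAC; apply: expmxD_gt0 Pj.
by apply: expmxD_gt0 Pi _; rewrite expr1.
Qed.

(** Any two states are joined by a positive entry of some power of [P], under which both
    distributions stay invariant. So the density of [mu] with respect to [pi] is constant, and the
    total masses agree. *)
Lemma unique_invariant_of_irreducible (pi : 'rV[R]_n) :
  mc_irreducible P -> (forall x, 0 < pi 0 x) -> invariant_distribution P pi ->
  unique (invariant_distribution P) pi.
Proof.
move=> irr pi0 inv_pi; split=> // mu [_ mu1 muP].
have [_ pi1 piP] := inv_pi.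
have powP (nu : 'rV[R]_n) k : nu *m P = nu -> nu *m P ^+ k = nu.
  move=> nuP; elim: k => [|k IH]; first by rewrite expr0 mulmx1.
  by rewrite exprS -[P * _]/(P *m _) mulmxA nuP.
have const x z : mu 0 x / pi 0 x = mu 0 z / pi 0 z.
  have [k _ Pk] := irr x z.
  apply: (invariant_density_step _ _ _ (expmx_stochastic k)) => //; exact: powP.
apply/rowP => x; rewrite -[LHS]mulr1 -mu1 mulr_sumr.
under eq_bigr => z _.
  rewrite (_ : pi 0 x * mu 0 z = mu 0 x * pi 0 z); first over.
  have /eqP := const x z.
  by rewrite eqr_div ?lt0r_neq0 // => /eqP ->; rewrite mulrC.
by rewrite -mulr_sumr pi1 mulr1.
Qed.

End StochasticPowers.

(** * Walks whose weight factorizes *)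

Section FactorizedWeight.
Variables (R : realType) (g : weight R) (n : nat) (u v k lam : nat -> R).
(** Positivity of [v] is asked only at 0 and 1: for natural b' the factor [rbinom (b' - 1) m]
    vanishes once m >= b'. *)
Hypotheses (n_gt0 : (0 < n)%N)
  (dom : forall x : nat, (x < n)%N -> in_domain (weight_dom g) x)
  (u_gt0 : forall y : nat, (y < n)%N -> 0 < u y)
  (v0_gt0 : 0 < v 0%N) (v1_gt0 : 0 < v 1%N)
  (k_gt0 : forall x : nat, (x < n)%N -> 0 < k x).
Hypothesis gE : forall y x : nat,
  (y <= x)%N -> (x < n)%N -> k x * g y x = u y * v (x - y)%N.
Hypothesis sum_bin_g : forall d x : nat, (d <= x)%N -> (x < n)%N ->
  \sum_(y < x.+1) g y x * 'C(y, d)%:R =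
  lam d * (weight_norm g x * 'C(x, d)%:R).

Let P := walk_matrix g n.

Let P_stochastic (y : 'I_n) : (forall z, 0 <= P y z) /\ \sum_z P y z = 1.
Proof. exact: walk_matrix_stochastic. Qed.

Let N_gt0 x : (x < n)%N -> 0 < weight_norm g x.
Proof. by move=> xn; apply: weight_norm_gt0; apply: dom. Qed.

(** In terms of the chosen y = n - 1 - z, the two cases are y = x and y = x - 1, where the weight
    involves [v 0] and [v 1]. *)
Let walk_edge_gt0 (x z : 'I_n) :
  (x + z = n - 1 \/ x + z = n)%N -> 0 < P x z.
Proof.
move=> xz; rewrite mxE divr_gt0 ?N_gt0 //.
have xn := ltn_ord x; have zn := ltn_ord z.
rewrite -(pmulr_rgt0 _ (k_gt0 x xn)) gE //=; last by lia.
rewrite mulr_gt0 ?u_gt0 //; first by lia.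
by case: xz => xz; [have -> : (x - (n - z.+1) = 0)%N by lia
  | have -> : (x - (n - z.+1) = 1)%N by lia].
Qed.

Let walk_irreducible : mc_irreducible P.
Proof.
pose conn x z := exists2 i : nat, (0 < i)%N & 0 < (P ^+ i) x z.
have conn_trans x y z : conn x y -> conn y z -> conn x z.
  move=> [i i0 Pi] [j _ Pj]; exists (i + j)%N; first by rewrite addn_gt0 i0.
  exact: expmxD_gt0 Pi Pj.
have edge (x z : 'I_n) : (x + z = n - 1 \/ x + z = n)%N -> conn x z.
  by move=> xz; exists 1%N; rewrite // expr1; apply: walk_edge_gt0.
have conn_rev (x z : 'I_n) : (x + z = n - 1)%N -> conn x z /\ conn z x.
  by move=> xz; split; apply: edge; left; lia.
(* Induction on the distance z - x, with both directions carried along. *)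
suff H m (x z : 'I_n) : (x + m = z)%N -> conn x z /\ conn z x.
  move=> x z; case: (leqP x z) => xz.
    by apply: (H (z - x)%N x z _).1; lia.
  by apply: (H (x - z)%N z x _).2; lia.
elim: m z => [|m IH] z xz.
  (* [conn] needs a positive number of steps, so x returns to itself via its reflection. *)
  have {xz} <- : x = z by apply: val_inj => /=; lia.
  have [|] := conn_rev x (rev_ord x) => /=; first by have := ltn_ord x; lia.
  by move=> c1 c2; split; exact: conn_trans c1 c2.
(* With y = z - 1, the walk passes between y and z through n - 1 - y, since (n - 1 - y) + z = n. *)
have zn := ltn_ord z; have yn : (x + m < n)%N by lia.
have [xy yx] := IH (Ordinal yn) erefl.
have [yr ry] : conn (Ordinal yn) (rev_ord (Ordinal yn)) /\
    conn (rev_ord (Ordinal yn)) (Ordinal yn).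
  by apply: conn_rev => /=; lia.
have rz : conn (rev_ord (Ordinal yn)) z by apply: edge; right => /=; lia.
have zr : conn z (rev_ord (Ordinal yn)) by apply: edge; right => /=; lia.
split; first exact: conn_trans xy (conn_trans _ _ _ yr rz).
exact: conn_trans zr (conn_trans _ _ _ ry yx).
Qed.

Let walk_aperiodic : mc_aperiodic P.
Proof.
(* Twice [n./2] is n or n - 1, so this state has a loop. *)
have ln : (n./2 < n)%N by lia.
apply: (aperiodic_of_loop _ _ _ P_stochastic (Ordinal ln)) => //.
by apply: walk_edge_gt0 => /=; lia.
Qed.

Let W (x : nat) : R := u (n - 1 - x)%N * (k x * weight_norm g x).

Let W_gt0 (x : 'I_n) : 0 < W x.
Proof. by rewrite /W !mulr_gt0 ?u_gt0 ?k_gt0 ?N_gt0 //; lia. Qed.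

(** Both sides equal u_(n-1-x) u_(n-1-z) v_(x+z-(n-1)), which is symmetric in x and z; if x + z < n
    - 1 both intervals are empty. *)
Let W_balance (x z : 'I_n) : W x * P x z = W z * P z x.
Proof.
have WP (s t : 'I_n) : W s * P s t = u (n - 1 - s)%N * (k s * g (n - t.+1)%N s).
  rewrite mxE /W /= -!mulrA; congr (_ * (_ * _)).
  by rewrite mulrC divfK // gt_eqF ?N_gt0.
rewrite !WP; have xn := ltn_ord x; have zn := ltn_ord z.
case: (leqP n (x + z).+1) => xz; last by rewrite !weight_empty ?mulr0 //; lia.
rewrite !gE; try lia.
have -> : (x - (n - z.+1) = z - (n - x.+1))%N by lia.
have -> : (n - x.+1 = n - 1 - x)%N by lia.
have -> : (n - z.+1 = n - 1 - z)%N by lia.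
by rewrite mulrCA.
Qed.

Let pi : 'rV[R]_n := \row_x ((\sum_z W (z : 'I_n))^-1 * W x).

Let sumW_gt0 : 0 < \sum_z W (z : 'I_n).
Proof.
rewrite (bigD1 (Ordinal n_gt0)) //= ltr_pwDl ?(W_gt0 (Ordinal n_gt0)) //.
by apply: sumr_ge0 => z _; exact/ltW.
Qed.

Let pi_gt0 x : 0 < pi 0 x.
Proof. by rewrite mxE mulr_gt0 ?invr_gt0. Qed.

Let pi_balance x z : pi 0 x * P x z = pi 0 z * P z x.
Proof. by rewrite ![pi _ _]mxE -[LHS]mulrA -[RHS]mulrA W_balance. Qed.

Let pi_invariant : invariant_distribution P pi.
Proof.
split=> [x||]; first exact/ltW.
  under eq_bigr => x _ do rewrite mxE.
  by rewrite -mulr_sumr mulVf // gt_eqF.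
apply/rowP => z; rewrite mxE.
under eq_bigr => x _ do rewrite pi_balance.
by rewrite -mulr_sumr (P_stochastic z).2 mulr1.
Qed.

(* In the basis of the functions x |-> 'C(x, d), choosing y is diagonal and
   y |-> n - 1 - y is upper triangular with diagonal entries (-1)^d. *)
Let B : 'M[R]_n := \matrix_(x, d) 'C(x, d)%:R.

(** Column d holds the coefficients from [bin_sub] of 'C(n - 1 - y, d) in the functions 'C(y, e),
    with row e scaled by [lam e]. *)
Let T : 'M[R]_n := \matrix_(e, d)
  (if (e <= d)%N then lam e * ((-1) ^+ e * 'C(n - 1 - e, d - e)%:R) else 0).

Let sum_bin_walk e x : (x < n)%N ->
  \sum_(y < n) g y x / weight_norm g x * 'C(y, e)%:R = lam e * 'C(x, e)%:R.
Proof.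
move=> xn.
under eq_bigr => y _ do rewrite mulrAC.
rewrite -mulr_suml.
apply: (canLR (mulfK _)); first by rewrite gt_eqF ?N_gt0.
rewrite -mulrA [_ * weight_norm _ _]mulrC.
transitivity (\sum_(y < x.+1) g y x * 'C(y, e)%:R).
  rewrite [RHS](big_ord_widen n (fun y => g y x * 'C(y, e)%:R)) //.
  rewrite [RHS]big_mkcond.
  by apply: eq_bigr => y _; case: ltnP => // xy; rewrite weight_empty ?mul0r.
case: (leqP e x) => ex; first exact: sum_bin_g.
rewrite [in RHS]bin_small // !mulr0 big1 // => y _.
by rewrite bin_small ?mulr0 // (leq_trans _ ex).
Qed.

(** A step evaluates 'C(-, d) at n - 1 - y; [bin_sub] expands this in the 'C(y, e), and averaging
    over y scales each of them by [lam e]. *)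
Let walk_conj : P *m B = B *m T.
Proof.
apply/matrixP => x d; rewrite !mxE (reindex_inj rev_ord_inj) /=.
pose c (e : nat) : R := (-1) ^+ e * 'C(n - 1 - e, d - e)%:R.
transitivity (\sum_(e < d.+1) c e *
    \sum_(y < n) g y x / weight_norm g x * 'C(y, e)%:R).
  under [RHS]eq_bigr => e _ do rewrite mulr_sumr.
  rewrite exchange_big /=; apply: eq_bigr => y _.
  have yn := ltn_ord y; rewrite !mxE rev_ordK /=.
  have -> : (n - y.+1 = n - 1 - y)%N by lia.
  rewrite (bin_sub R); last by lia.
  by rewrite mulr_sumr; apply: eq_bigr => e _; rewrite /c; ring.
under [LHS]eq_bigr => e _ do rewrite sum_bin_walk //.
rewrite (big_ord_widen n (fun e => c e * (lam e * 'C(x, e)%:R))) // big_mkcond.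
apply: eq_bigr => e _; rewrite !mxE ltnS; case: ifP => _; last by rewrite mulr0.
by rewrite mulrA [RHS]mulrC; congr (_ * _); rewrite mulrC.
Qed.

Let walk_char_poly :
  char_poly P = \prod_(d < n) ('X - ((-1) ^+ d * lam d)%:P).
Proof.
rewrite (char_poly_conj _ _ _ B T _ walk_conj).
  rewrite char_poly_upper_trig => [|i j ji]; last by rewrite mxE leqNgt ji.
  by apply: eq_bigr => d _; rewrite mxE leqnn subnn bin0 mulr1 mulrC.
(* [B] is lower triangular with diagonal entries 'C(d, d) = 1, so its determinant is 1. *)
rewrite det_trig.
  by rewrite big1 ?oner_eq0 // => d _; rewrite mxE binn.
by apply/is_trig_mxP => x d xd; rewrite mxE bin_small.
Qed.

Lemma factorized_walk :
  [/\ [/\ mc_irreducible P, mc_recurrent P, mc_reversible P & mc_ergodic P],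
      exists pi : 'rV[R]_n, unique (invariant_distribution P) pi /\
        proportional_to pi (fun x =>
          u (n - 1 - x)%N * (k x * weight_norm g x)),
      has_eigenvalues P (fun d => (-1) ^+ d * lam d) &
      forall d : 'I_n, P d (rev_ord d) = lam d].
Proof.
split; first split=> //.
- by case: pi_invariant => _ _; apply: recurrent_of_invariant.
- by exists pi.
- exists pi; split; first exact: unique_invariant_of_irreducible.
  exists (\sum_z W (z : 'I_n))^-1; first by rewrite invr_eq0 gt_eqF.
  by move=> x; rewrite mxE.
- split; last exact: walk_char_poly.
  exact: (eigenvalues_of_char_poly _ _ _ (fun d => (-1) ^+ d * lam d)
    walk_char_poly).
- move=> d; rewrite mxE rev_ordK.
  apply: (canLR (mulfK _)); first by rewrite gt_eqF ?N_gt0.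
  (* For x = d only the term y = d survives in [sum_bin_g], and it gives the anti-diagonal entry. *)
  have := sum_bin_g d d (leqnn d) (ltn_ord d).
  rewrite binn mulr1 => <-; rewrite big_ord_recr /= binn mulr1 big1 ?add0r //.
  by move=> y _; rewrite bin_small ?mulr0.
Qed.

End FactorizedWeight.

(** * Sums of binomial coefficients with real upper argument *)

Section BinomialSums.
Variable R : realType.
Implicit Types r s : R.

Lemma rbinomS r d : d.+1%:R * rbinom r d.+1 = (r - d%:R) * rbinom r d.
Proof.
have d0 : d.+1%:R != 0 :> R by rewrite pnatr_eq0.
have f0 : d`!%:R != 0 :> R by rewrite pnatr_eq0 -lt0n fact_gt0.
rewrite /rbinom factS natrM big_ord_recr /= invfM; field.
by rewrite f0 nat1r d0.
Qed.

(** Induction on x: multiply by x + 1 = y + (x + 1 - y), absorb each part by [rbinomS], and use (r -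
    y) + (s - (x - y)) = r + s - x. *)
Lemma rbinom_vandermonde r s x :
  \sum_(y < x.+1) rbinom r y * rbinom s (x - y) = rbinom (r + s) x.
Proof.
elim: x => [|x IH]; first by rewrite big_ord1 !rbinom0 mulr1.
have x0 : x.+1%:R != 0 :> R by rewrite pnatr_eq0.
apply: (mulfI x0); rewrite rbinomS -IH !mulr_sumr.
transitivity (\sum_(y < x.+2) (y%:R * rbinom r y * rbinom s (x.+1 - y)) +
    \sum_(y < x.+2) (rbinom r y * ((x.+1 - y)%:R * rbinom s (x.+1 - y)))).
  rewrite -big_split; apply: eq_bigr => y _ /=.
  have yx : (y <= x.+1)%N by rewrite -ltnS ltn_ord.
  by rewrite (natrB _ yx); ring.
rewrite big_ord_recl !mul0r add0r.
rewrite [X in _ + X]big_ord_recr /= subnn mul0r mulr0 addr0 -big_split.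
apply: eq_bigr => y _; rewrite /= /bump leq0n add1n subSS rbinomS.
have yx : (y <= x)%N by rewrite -ltnS ltn_ord.
by rewrite subSn // rbinomS natrB //; ring.
Qed.

(** Trinomial revision: the falling product of length d + j splits after d factors. *)
Lemma rbinom_bin r d j :
  rbinom r (d + j) * 'C(d + j, d)%:R = rbinom r d * rbinom (r - d%:R) j.
Proof.
have f0 i : i`!%:R != 0 :> R by rewrite pnatr_eq0 -lt0n fact_gt0.
have bE : 'C(d + j, d)%:R = (d + j)`!%:R / (d`!%:R * j`!%:R) :> R.
  apply: (canRL (mulfK _)); first by rewrite mulf_neq0.
  by rewrite -!natrM -{2}[j](addKn d) bin_fact ?leq_addr.
rewrite bE /rbinom big_split_ord /=.
under [X in _ * X / _]eq_bigr => i _ do rewrite natrD opprD addrA.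
by field; rewrite !f0.
Qed.

(** Upper negation: the product is reversed and every factor changes sign. *)
Lemma rbinom_negate r y : rbinom (y%:R + r) y = (-1) ^+ y * rbinom (- r - 1) y.
Proof.
rewrite /rbinom mulrA; congr (_ / _).
rewrite -[X in _ ^+ X]card_ord -prodrN (reindex_inj rev_ord_inj) /=.
by apply: eq_bigr => i _; rewrite natrB // -natr1; ring.
Qed.

Lemma sum_bin_shift (F : nat -> R) d x : (d <= x)%N ->
  \sum_(y < x.+1) F y * 'C(y, d)%:R =
  \sum_(j < (x - d).+1) F (d + j)%N * 'C(d + j, d)%:R.
Proof.
move=> dx; pose G y := F y * 'C(y, d)%:R.
rewrite -(big_mkord xpredT G) (big_cat_nat (n := d)) //=; last exact: ltnW.
rewrite big_nat_cond big1 ?add0r => [|y]; last first.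
  by move=> /andP[/andP[_ yd] _]; rewrite /G bin_small ?mulr0.
rewrite -{1}[d]add0n big_addn big_mkord subSn //.
by apply: eq_bigr => j _; rewrite /G addnC.
Qed.

(* On polynomials in y of degree d, convolution acts on the basis 'C(y, d) as
   multiplication by a scalar, up to the norming factor rbinom (r + s) x. *)
Lemma sum_bin_rbinom r s d x : (d <= x)%N -> rbinom (r + s) d != 0 ->
  \sum_(y < x.+1) rbinom r y * rbinom s (x - y) * 'C(y, d)%:R =
  rbinom r d / rbinom (r + s) d * (rbinom (r + s) x * 'C(x, d)%:R).
Proof.
move=> dx rs0.
rewrite (sum_bin_shift (fun y => rbinom r y * rbinom s (x - y))) //.
(* Trinomial revision on both sides leaves Vandermonde's convolution for r - d and s at x - d. *)
rewrite -[in RHS](subnKC dx) rbinom_bin.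
rewrite -mulrA mulKf // addrAC -rbinom_vandermonde mulr_sumr.
by apply: eq_bigr => j _; rewrite mulrAC rbinom_bin subnDA mulrA.
Qed.

(** Since 'C(x, d + j) 'C(d + j, d) = 'C(x, d) 'C(x - d, j), this is the binomial theorem with
    exponent x - d. *)
Lemma sum_bin_binomial (c : R) d x : (d <= x)%N ->
  \sum_(y < x.+1) 'C(x, y)%:R * c ^+ (x - y) * 'C(y, d)%:R =
  (c + 1) ^+ (x - d) * 'C(x, d)%:R.
Proof.
move=> dx.
rewrite (sum_bin_shift (fun y => 'C(x, y)%:R * c ^+ (x - y))) // exprDn mulr_suml.
apply: eq_bigr => j _.
have jx : (j <= x - d)%N by rewrite -ltnS ltn_ord.
rewrite expr1n mulr1 -[in RHS]mulr_natr -[RHS]mulrA -natrM mulrAC -natrM mulrC.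
rewrite subnDA; congr (_ * _%:R).
(* Multiplied by these factorials, both products of binomial coefficients become x!. *)
have f0 : (0 < (x - (d + j))`! * (d`! * j`!))%N by rewrite !muln_gt0 !fact_gt0.
apply/eqP; rewrite -(eqn_pmul2r f0).
have djx : (d + j <= x)%N by lia.
have E1 := bin_fact djx; have E2 := bin_fact (leq_addr j d).
have E3 := bin_fact jx; have E4 := bin_fact dx.
rewrite addKn in E2; rewrite -subnDA in E3.
by apply/eqP; rewrite -E2 in E1; rewrite -E3 in E4; nia.
Qed.

End BinomialSums.

(** * Application to the three weights *)

Lemma proportional_to_scale (R : realType) (n : nat) (pi : 'rV[R]_n)
    (w w' : nat -> R) (t : R) :
  t != 0 -> (forall x : nat, (x < n)%N -> w x = t * w' x) ->
  proportional_to pi w -> proportional_to pi w'.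
Proof.
move=> t0 ww' [k k0 piE]; exists (k * t); first by rewrite mulf_neq0.
by move=> x; rewrite piE ww' // mulrA.
Qed.

(** Upper negation reduces this to [sum_bin_rbinom] with r = -a-1 and s = -b-1: the signs (-1)^y and
    (-1)^(x-y) combine to (-1)^x, and those in the quotient cancel. *)
Lemma gamma_ab_sum_bin (R : realType) (a b : R) (d x : nat) :
  -1 < a -> -1 < b -> (d <= x)%N ->
  \sum_(y < x.+1) gamma_ab_val a b y x * 'C(y, d)%:R =
  rbinom (a + d%:R) d / rbinom (a + b + d%:R + 1) d *
    (rbinom (x%:R + a + b + 1) x * 'C(x, d)%:R).
Proof.
move=> ha hb dx.
have -> : a + d%:R = d%:R + a by rewrite addrC.
have -> : a + b + d%:R + 1 = d%:R + (a + b + 1) by ring.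
have -> : x%:R + a + b + 1 = x%:R + (a + b + 1) by ring.
have rs : - (a + b + 1) - 1 = (- a - 1) + (- b - 1) by ring.
(* Nonvanishing is shown before negation, where all factors are positive. *)
have rs0 : rbinom (d%:R + (a + b + 1)) d != 0.
  by rewrite lt0r_neq0 // rbinom_gt0 // -addrA ltrDl; lra.
rewrite !rbinom_negate !rs in rs0 *.
rewrite mulf_eq0 negb_or signr_eq0 /= in rs0.
rewrite -mulf_div divff ?signr_eq0 // mul1r.
rewrite -[_ * _ * 'C(x, d)%:R]mulrA mulrCA -sum_bin_rbinom // mulr_sumr.
apply: eq_bigr => y _.
have yx : (y <= x)%N by rewrite -ltnS ltn_ord.
rewrite /gamma_ab_val yx (addrC b) !rbinom_negate.
have -> : (-1) ^+ x = (-1) ^+ y * (-1) ^+ (x - y) :> R.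
  by rewrite -exprD subnKC.
by ring.
Qed.

Lemma delta_size_lt (R : realType) (a b : R) (x : nat) :
  1 < a -> (x < delta_size a b)%N -> x%:R < a.
Proof.
move=> a1 xs; have {xs} : (x < `|Num.ceil a|)%N.
  apply: leq_trans xs _; rewrite /delta_size.
  by case: ifP => // _; apply: geq_minl.
rewrite -ltz_nat gez0_abs; first by rewrite ceil_gt_int.
by rewrite ceil_ge0; lra.
Qed.

Theorem theorem1p5 (R : realType) (a b c a' b' : R)
    (ha : -1 < a) (hb : -1 < b) (hc : 0 < c) (ha' : 1 < a') (hb' : 1 < b') :
  [/\ forall n : nat, (0 < n)%N ->
        (forall x : nat, (x < n)%N -> in_domain (weight_dom (gamma_ab ha hb)) x) ->
        let P := walk_matrix (gamma_ab ha hb) n in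
        [/\ [/\ mc_irreducible P, mc_recurrent P, mc_reversible P & mc_ergodic P],
            exists pi : 'rV[R]_n,
              unique (invariant_distribution P) pi /\
              proportional_to pi (fun x =>
                rbinom ((n - 1 - x)%:R + a) (n - 1 - x)
                * rbinom (x%:R + a + b + 1) x),
            has_eigenvalues P (fun d =>
              (-1) ^+ d * (rbinom (a + d%:R) d / rbinom (a + b + d%:R + 1) d)) &
            forall d : 'I_n,
              P d (rev_ord d) = rbinom (a + d%:R) d / rbinom (a + b + d%:R + 1) d],
      forall n : nat, (0 < n)%N ->
        (forall x : nat, (x < n)%N -> in_domain (weight_dom (gamma_c hc)) x) ->
        let P := walk_matrix (gamma_c hc) n in
        [/\ [/\ mc_irreducible P, mc_recurrent P, mc_reversible P & mc_ergodic P],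
            exists pi : 'rV[R]_n,
              unique (invariant_distribution P) pi /\
              proportional_to pi (fun x => 'C(n - 1, x)%:R * (c + 1) ^+ x),
            has_eigenvalues P (fun d => (-1) ^+ d / (c + 1) ^+ d) &
            forall d : 'I_n, P d (rev_ord d) = 1 / (c + 1) ^+ d] &
      forall n : nat, (0 < n)%N ->
        (forall x : nat, (x < n)%N -> in_domain (weight_dom (delta_ab ha' hb')) x) ->
        let P := walk_matrix (delta_ab ha' hb') n in
        [/\ [/\ mc_irreducible P, mc_recurrent P, mc_reversible P & mc_ergodic P],
            exists pi : 'rV[R]_n,
              unique (invariant_distribution P) pi /\
              proportional_to pi (fun x =>
                rbinom (a' - 1) (n - 1 - x) * rbinom ((a' - 1) + (b' - 1)) x),
            has_eigenvalues P (fun d =>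
              (-1) ^+ d * (rbinom (a' - 1) d / rbinom ((a' - 1) + (b' - 1)) d)) &
            forall d : 'I_n,
              P d (rev_ord d) = rbinom (a' - 1) d / rbinom ((a' - 1) + (b' - 1)) d]].
Proof.
split=> n n0 dom P.
(* The case d = 0 of the sum formula gives the norm. *)
- have normE x : weight_norm (gamma_ab ha hb) x = rbinom (x%:R + a + b + 1) x.
    have := gamma_ab_sum_bin _ _ _ _ _ ha hb (leq0n x).
    rewrite !rbinom0 !divr1 mul1r bin0 mulr1 => <-.
    by apply: eq_bigr => y _; rewrite bin0 mulr1.
  have [||||||||] := factorized_walk R (gamma_ab ha hb) n
    (fun y => rbinom (y%:R + a) y) (fun y => rbinom (y%:R + b) y) (fun=> 1)
    (fun d => rbinom (a + d%:R) d / rbinom (a + b + d%:R + 1) d) => //.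
  + by move=> y _; rewrite rbinom_gt0 // -addrA ltrDl; lra.
  + by rewrite rbinom_gt0 // add0r; lra.
  + by rewrite rbinom_gt0 //; lra.
  + by move=> y x yx _; rewrite mul1r /= /gamma_ab_val yx (addrC b).
  + by move=> d x dx _; rewrite normE; exact: gamma_ab_sum_bin.
  move=> basic [pi [pi_uniq pi_prop]] eig diag; split=> //.
  exists pi; split=> //.
  apply: (proportional_to_scale _ _ _ _ _ 1 (oner_neq0 _) _ pi_prop).
  by move=> x _; rewrite normE !mul1r.
- have c1 : c + 1 != 0 by rewrite lt0r_neq0; lra.
  have normE x : weight_norm (gamma_c hc) x = (c + 1) ^+ x.
    have := sum_bin_binomial _ c _ _ (leq0n x).
    rewrite subn0 bin0 mulr1 => <-.
    by apply: eq_bigr => y _; rewrite bin0 mulr1.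
  have f0 (m : nat) : m`!%:R != 0 :> R by rewrite pnatr_eq0 -lt0n fact_gt0.
  have finv_gt0 (m : nat) : 0 < m`!%:R^-1 :> R by rewrite invr_gt0 ltr0n fact_gt0.
  (* The factorization is 'C(x, y) c^(x-y) = x! (1/y!) (c^(x-y)/(x-y)!). *)
  have [||||||||] := factorized_walk R (gamma_c hc) n
    (fun y => y`!%:R^-1) (fun m => c ^+ m / m`!%:R) (fun x => x`!%:R^-1)
    (fun d => ((c + 1) ^+ d)^-1) => //.
  + by rewrite mul1r.
  + by rewrite expr1 divr1.
  + move=> y x yx _; rewrite /= /gamma_c_val -(bin_fact yx) !natrM.
    have := f0 y; have := f0 (x - y)%N.
    have : 'C(x, y)%:R != 0 :> R by rewrite pnatr_eq0 -lt0n bin_gt0.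
    by move=> h1 h2 h3; field; rewrite h1 h2 h3.
  + move=> d x dx _; rewrite normE sum_bin_binomial // mulrA; congr (_ * _).
    by rewrite -[in RHS](subnKC dx) exprD mulKf // expf_neq0.
  move=> basic [pi [pi_uniq pi_prop]] eig diag; split=> //; last first.
    by move=> d; rewrite mul1r diag.
  exists pi; split=> //.
  (* The constant is 1/(n-1)!, because 1/((n-1-x)! x!) = 'C(n-1, x)/(n-1)!. *)
  apply: (proportional_to_scale _ _ _ _ _ _
    (lt0r_neq0 (finv_gt0 (n - 1)%N)) _ pi_prop).
  move=> x xn; rewrite normE !mulrA; congr (_ * _).
  have xn1 : (x <= n - 1)%N by lia.
  rewrite -(bin_fact xn1) !natrM.
  have := f0 x; have := f0 (n - 1 - x)%N.
  have : 'C(n - 1, x)%:R != 0 :> R by rewrite pnatr_eq0 -lt0n bin_gt0.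
  by move=> h1 h2 h3; field; rewrite h1 h2 h3.
- have normE x : weight_norm (delta_ab ha' hb') x =
      rbinom ((a' - 1) + (b' - 1)) x.
    rewrite -rbinom_vandermonde; apply: eq_bigr => y _.
    by rewrite /= /delta_val -ltnS ltn_ord.
  have xa x : (x < n)%N -> x%:R < a'.
    by move=> xn; apply: delta_size_lt ha' (dom x xn).
  have [||||||||] := factorized_walk R (delta_ab ha' hb') n
    (fun y => rbinom (a' - 1) y) (fun y => rbinom (b' - 1) y) (fun=> 1)
    (fun d => rbinom (a' - 1) d / rbinom ((a' - 1) + (b' - 1)) d) => //.
  + by move=> y /xa ya; rewrite rbinom_gt0 // subrK.
  + by rewrite rbinom0.
  + by rewrite rbinom_gt0 //; lra.
  + by move=> y x yx _; rewrite mul1r /= /delta_val yx.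
  + move=> d x dx xn; rewrite normE -sum_bin_rbinom //.
      apply: eq_bigr => y _.
      by rewrite /= /delta_val -ltnS ltn_ord.
    (* As b' > 1, d < a' implies d < a' + b' - 1, so the divisor is positive. *)
    have := xa d (leq_ltn_trans dx xn) => da.
    by rewrite lt0r_neq0 // rbinom_gt0 //; lra.
  move=> basic [pi [pi_uniq pi_prop]] eig diag; split=> //.
  exists pi; split=> //.
  apply: (proportional_to_scale _ _ _ _ _ 1 (oner_neq0 _) _ pi_prop).
  by move=> x _; rewrite normE !mul1r.
Qed.
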